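(* Let $n\in\{4,5\}$ and let $m\geq 8$ be an integer. Then $R(\mathcal{B}^3K_m,\mathcal{B}^3C_n)=m+1$. Moreover, for all integers $m,n$ with $m\geq n\geq 6$ and $m\geq 11$, $R(\mathcal{B}^3K_m,\mathcal{B}^3C_n)=m+\left\lfloor\frac{n-1}{2}\right\rfloor-1$.
   Context: A hypergraph $\mathcal{H}=(V,E)$ consists of a finite non-empty vertex set $V=V(\mathcal{H})$ and a set $E=E(\mathcal{H})$ of distinct non-empty subsets of $V$ (hyperedges). It is $r$-uniform if all hyperedges have size $r$. The complete $r$-uniform hypergraph $\mathcal{K}_N^r$ has $N$ vertices and all $r$-subsets of its vertex set as hyperedges. For a graph $G$, a hypergraph $\mathcal{H}$ (whose vertex set contains $V(G)$, after identification) is called Berge-$G$ if there is a bijection $\Phi:E(G)\to E(\mathcal{H})$ with $e\subseteq\Phi(e)$ for every $e\in E(G)$. $\mathcal{B}^rG$ denotes the family of all $r$-uniform Berge-$G$ hypergraphs. $C_n$ is the cycle of length $n$ and $K_m$ is the complete graph on $m$ vertices. Thus a member of $\mathcal{B}^rC_n$ is given by distinct vertices $v_1,\dots,v_n$ and distinct hyperedges $h_1,\dots,h_n$ of size $r$ with $\{v_i,v_{i+1}\}\subseteq h_i$ for all $i$ (indices modulo $n$); a member of $\mathcal{B}^rK_m$ is given by distinct vertices $v_1,\dots,v_m$ and $\binom m2$ distinct hyperedges $h_{ij}$ ($1\le i<j\le m$) of size $r$ with $\{v_i,v_j\}\subseteq h_{ij}$. For families $\mathcal{H}_1,\dots,\mathcal{H}_t$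 of $r$-uniform hypergraphs, the Ramsey number $R(\mathcal{H}_1,\dots,\mathcal{H}_t)$ is the smallest integer $N$ such that every coloring of the hyperedges of $\mathcal{K}_N^r$ with $t$ colors $1,\dots,t$ contains, for some $1\le i\le t$, a (not necessarily induced) copy of some member of $\mathcal{H}_i$ all of whose hyperedges have color $i$. *)

(* Defs.v *)
From mathcomp Require Import all_boot.

Set Implicit Arguments.
Unset Strict Implicit.
Unset Printing Implicit Defensive.

(* Raw data of a hypergraph; the standing conditions (nonempty vertex set,
   nonempty hyperedges) are the separate predicate [is_hypergraph], so that
   [complete] and [cycle_graph] are total in their numeric parameters. *)
Record set_system := SetSystem {
  vertex : finType;
  edges : {set {set vertex}}
}.

Definition is_hypergraph (H : set_system) : bool :=
  (0 < #|vertex H|) && (set0 \notin edges H).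

Definition uniform (r : nat) (H : set_system) : bool :=
  [forall h in edges H, #|h| == r].

Definition complete (r N : nat) : set_system :=
  @SetSystem 'I_N [set h : {set 'I_N} | #|h| == r].

(* Graphs are 2-uniform set systems. *)
Definition complete_graph (m : nat) : set_system := complete 2 m.

(* [ordS] is the cyclic successor on 'I_n; this is the cycle C_n for 3 <= n,
   and is degenerate (not a graph cycle) for smaller n. *)
Definition cycle_graph (n : nat) : set_system :=
  @SetSystem 'I_n [set [set i; ordS i] | i : 'I_n].

(* [iota] is the identification of V(G) with a subset of V(H); [Phi] matters
   only on E(G), where it is a bijection onto E(H). *)
Definition is_berge (G H : set_system) : Prop :=
  exists (iota : vertex G -> vertex H) (Phi : {set vertex G} -> {set vertex H}),
    [/\ injective iota,
        {in edges G &, injective Phi},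
        Phi @: edges G = edges H
      & forall e, e \in edges G -> iota @: e \subset Phi e].

Definition family := set_system -> Prop.

Definition berge (r : nat) (G : set_system) : family :=
  fun H => [/\ is_hypergraph H, uniform r H & is_berge G H].

(* A not necessarily induced copy of H in K, all of whose hyperedges have
   colour i. *)
Definition mono_copy (t : nat) (K : set_system) (c : {set vertex K} -> 'I_t)
    (i : 'I_t) (H : set_system) : Prop :=
  exists f : vertex H -> vertex K,
    injective f /\
    forall h, h \in edges H -> f @: h \in edges K /\ c (f @: h) = i.

(* A colouring is a function on all vertex subsets, of which only the values on
   the hyperedges of the complete r-uniform hypergraph are ever used. *)
Definition ramsey_property (r t : nat) (F : 'I_t -> family) (N : nat) : Prop :=
  forall c : {set vertex (complete r N)} -> 'I_t,
    exists (i : 'I_t) (H : set_system), F i H /\ mono_copy c i H.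

Definition is_ramsey_number (r t : nat) (F : 'I_t -> family) (N : nat) : Prop :=
  ramsey_property r F N /\ forall M, ramsey_property r F M -> N <= M.

Definition pair_families (F1 F2 : family) (i : 'I_2) : family :=
  if i == ord0 then F1 else F2.

(* Main.v *)
Require Import Defs.
From mathcomp Require Import all_boot.
From mathcomp Require Import zify.

Set Implicit Arguments.
Unset Strict Implicit.
Unset Printing Implicit Defensive.

(** Call triples of the clique colour red and triples of the cycle colour blue.
    Put k = 2 for n = 4 and k = (n - 1) / 2, rounded down, otherwise, so that
    the claimed Ramsey number is N = m + k - 1.

    Lower bound ([two_heavy_colouring]).  On fewer than N vertices fix a set A
    of at most k vertices and colour a triple blue when it meets A in at least two
    points.  A red Berge clique has at most one core vertex in A, and too few
    vertices lie outside A.  In a blue Berge cycle one of any two consecutive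
    vertices lies in A, so n <= 2 k; the only case not excluded by this is
    n = 4, where two of the hyperedges would have to coincide.

    Upper bound.  A pair is thick when at most two red triples contain it.

    - Red side ([cover_number_ge_or_clique]).  If some set of fewer than k
      vertices meets all thick pairs, at least m vertices remain and every pair
      of them lies in at least three red triples.  A triple contains only three
      pairs, so Hall's theorem assigns distinct red triples to the pairs, and
      there is a red Berge clique.

    - Blue side ([long_berge_cycle], [short_berge_cycle]).  Otherwise the thick
      pairs, viewed as a graph, have no cover of fewer than k vertices.  For a
      thick pair e, the triple e + x is blue for all but at most two x.  Thus vertices
      a_1, ..., a_s with thick pairs e_i containing a_i can be joined into the
      blue Berge cycle a_1 x_1 a_2 x_2 ... a_s x_s, with hyperedges e_i + x_i
      and e_(i+1) + x_i, for fresh vertices x_i, as long as consecutive e_i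
      differ ([weave_cycle]).  If e_i = {a_i, b}, then b can be put right after
      a_i, the new hyperedge being e_i + z with z fresh
      ([berge_cycle_insert]); this repairs the parity of the length.

    The fresh vertices must suffice, hence the pairs e_i should span few
    vertices.  A set W in which every vertex has a thick partner inside W spans
    all its pairs, and such sets grow by one or two vertices at a time
    ([isolation_free_size]).  This gives W of size k + 1 or k + 2.  If size
    k + 1 is impossible, then W induces a perfect matching
    ([isolation_free_shrink]); then k is even and W contains two disjoint pairs
    to use for insertions.  That consecutive pairs can be made distinct is
    [cyclic_order], which needs at least four vertices; the lengths 4, 5, 6 and
    7 use explicit choices of pairs. *)

(** * Systems of distinct representatives *)

(** Halmos and Vaughan: if some nonempty proper subset T is tight, match T and
    the rest separately, the rest avoiding the neighbours of T; if there is no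
    such subset, any single choice leaves Hall's condition true for the rest. *)
Lemma hall_marriage (X Y : finType) (y0 : Y) (S : {set X}) (N : X -> {set Y}) :
    (forall T : {set X}, T \subset S -> #|T| <= #|\bigcup_(x in T) N x|) ->
  exists2 f : X -> Y, {in S &, injective f} & {in S, forall x, f x \in N x}.
Proof.
have [n] := ubnP #|S|; elim: n S N => // n IHn S N ltSn hallN.
have [T /and3P[T0 ltTS /eqP tightT] | slack] :=
    pickP [pred T : {set X} | [&& T != set0, T \proper S &
                               #|T| == #|\bigcup_(x in T) N x|]].
  have sTS := proper_sub ltTS.
  have [|T' sT'T|f injf fN] := IHn T N.
  - by move: (proper_card ltTS) ltSn; lia.
  - by apply: hallN; apply: subset_trans sTS.
  pose M := \bigcup_(x in T) N x.
  have [||g injg gN] := IHn (S :\: T) (fun x => N x :\: M).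
  - have := cardsD S T; rewrite (setIidPr sTS).
    by move: T0 ltSn (subset_leq_card sTS); rewrite -card_gt0; lia.
  - move=> U sU; have /hallN : T :|: U \subset S.
      by rewrite subUset sTS (subset_trans sU) ?subsetDl.
    have /eqP-> : #|T :|: U| == #|T| + #|U|.
      rewrite cardsU (_ : T :&: U = set0) ?cards0 ?subn0 //.
      apply/eqP; rewrite setI_eq0 disjoint_sym; apply/pred0P => x /=.
      apply/negP => /andP[/(subsetP sU)]; rewrite inE => /andP[/negP nT _] xT.
      exact: nT.
    have -> : \bigcup_(x in T :|: U) N x
              = M :|: \bigcup_(x in U) (N x :\: M).
      apply/setP => y; rewrite in_setU; apply/bigcupP/orP => [[x]|].
        rewrite inE => /orP[xT yN|xU yN]; first by left; apply/bigcupP; exists x.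
        have [yM|yM] := boolP (y \in M); first by left.
        by right; apply/bigcupP; exists x; rewrite // inE yM.
      case=> /bigcupP[x xT yN]; exists x => //; rewrite ?inE ?xT ?orbT //.
      by move: yN; rewrite inE => /andP[].
    move=> le_TU; have := cardsU M (\bigcup_(x in U) (N x :\: M)).
    move: le_TU; rewrite tightT -/M; lia.
  exists (fun x => if x \in T then f x else g x) => [x y xS yS | x xS] /=.
    have fM z : z \in T -> f z \in M by move=> zT; apply/bigcupP; exists z; auto.
    have gM z : z \in S -> z \notin T -> (g z \in N z) && (g z \notin M).
      move=> zS zT; have : z \in S :\: T by rewrite inE zT.
      by move/gN; rewrite inE andbC.
    case: ifP => xT; case: ifP => yT; first exact: injf.
    - by move=> e; case/andP: (gM y yS (negbT yT)) => _; rewrite -e fM.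
    - by move=> e; case/andP: (gM x xS (negbT xT)) => _; rewrite e fM.
    - by apply: injg; rewrite inE ?xT ?yT.
  case: ifP => xT; first exact: fN.
  by have := gN x; rewrite !inE xT xS => /(_ isT)/andP[].
have [-> | [x xS]] := set_0Vmem S.
  by exists (fun=> y0) => [? ?|?]; rewrite inE.
have [Nx | [y yN]] := set_0Vmem (N x).
  exfalso; have /hallN : [set x] \subset S by rewrite sub1set.
  by rewrite big_set1 Nx cards0 cards1.
have [||g injg gN] := IHn (S :\ x) (fun z => N z :\ y).
- by move: ltSn; rewrite (cardsD1 x S) xS; lia.
- move=> U sU; have [->|U0] := eqVneq U set0; first by rewrite cards0.
  have ltU : U \proper S by apply: sub_proper_trans sU (properD1 xS).
  have := hallN U (proper_sub ltU); have := slack U.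
  rewrite /= U0 ltU /= => ne_U le_U.
  have -> : \bigcup_(z in U) (N z :\ y) = (\bigcup_(z in U) N z) :\ y.
    apply/setP => w; rewrite in_setD1; apply/bigcupP/andP => [[z zU]|].
      by rewrite in_setD1 => /andP[-> wN]; split=> //; apply/bigcupP; exists z.
    by case=> wy /bigcupP[z zU wN]; exists z; rewrite // in_setD1 wy.
  have := cardsD1 y (\bigcup_(z in U) N z); case: (y \in _); lia.
have gy z : z \in S -> z != x -> (g z != y) && (g z \in N z).
  by move=> zS zx; have := gN z; rewrite !inE zS zx; apply.
exists (fun z => if z == x then y else g z) => [u v uS vS | u uS] /=.
  case: eqP => [->|/eqP ux]; case: eqP => [->|/eqP vx] // e.
  - by have := gy v vS vx; rewrite -e eqxx.
  - by have := gy u uS ux; rewrite e eqxx.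
  - by apply: injg => //; rewrite !inE ?ux ?vx.
by case: eqP => [->|/eqP ux] //; case/andP: (gy u uS ux).
Qed.

(** Hall's condition by double counting: a set T sends at least d * #|T| edges
    to its neighbours, each of which receives at most d. *)
Lemma sdr_of_degrees (X Y : finType) (y0 : Y) (d : nat) (S : {set X})
    (N : X -> {set Y}) :
    0 < d -> {in S, forall x, d <= #|N x|} ->
    (forall y, #|[set x in S | y \in N x]| <= d) ->
  exists2 f : X -> Y, {in S &, injective f} & {in S, forall x, f x \in N x}.
Proof.
move=> d0 degX degY; apply: hall_marriage => // T sTS.
rewrite -(leq_pmul2l d0) (leq_trans (n := \sum_(x in T) #|N x|)) //.
  rewrite mulnC -sum_nat_const; apply: leq_sum => x xT.
  exact/degX/(subsetP sTS).
have -> : \sum_(x in T) #|N x|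
          = \sum_(y in \bigcup_(x in T) N x) #|[set x in T | y \in N x]|.
  under eq_bigr => x do rewrite -sum1_card.
  rewrite (exchange_big_dep (mem (\bigcup_(x in T) N x))) /=; last first.
    by move=> x y xT yN; apply/bigcupP; exists x.
  apply: eq_bigr => y _; rewrite sum1_card; apply: eq_card => x.
  by rewrite !inE.
rewrite mulnC -sum_nat_const; apply: leq_sum => y _.
apply: leq_trans (degY y); apply/subset_leq_card/subsetP => x.
by rewrite !inE => /andP[/(subsetP sTS)-> ->].
Qed.

(** The threshold 3 is the number of pairs inside a triple. *)
Lemma berge_clique_assignment (T : finType) (R : {set {set T}}) (S : {set T}) :
    {in R, forall h : {set T}, #|h| = 3} ->
    (forall e : {set T}, e \subset S -> #|e| = 2 ->
       3 <= #|[set h in R | e \subset h]|) ->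
  exists2 F : {set T} -> {set T},
      {in [set e : {set T} | e \subset S & #|e| == 2] &, injective F}
    & forall e : {set T}, e \subset S -> #|e| = 2 ->
        F e \in R /\ e \subset F e.
Proof.
move=> unif deg.
have [|||F injF FN] := @sdr_of_degrees {set T} {set T} set0 3
  [set e : {set T} | e \subset S & #|e| == 2]
  (fun e => [set h in R | e \subset h]) => //.
- by move=> e; rewrite inE => /andP[eS /eqP]; apply: deg.
- move=> h; have [hR|hR] := boolP (h \in R); last first.
    rewrite (_ : [set _ in _ | _] = set0) ?cards0 //.
    by apply/setP => e; rewrite !inE (negPf hR) andbF.
  have <- : 'C(#|h|, 2) = 3 by rewrite unif.
  rewrite -cards_draws.
  apply/subset_leq_card/subsetP => e.
  by rewrite !inE => /andP[/andP[_ ->] /andP[_ ->]].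
exists F => // e eS e2; have := FN e; rewrite !inE eS e2 eqxx => /(_ isT).
by case/andP.
Qed.

(** * Thick pairs and the weaving of blue cycles *)

Definition ban (T : finType) (B : {set {set T}}) (e : {set T}) : {set T} :=
  [set x | (x \notin e) && (x |: e \notin B)].

(** The complement of the condition in [berge_clique_assignment]: when B is the
    set of blue triples, a pair is thick when fewer than three red ones contain
    it. *)
Definition thick (T : finType) (B : {set {set T}}) (e : {set T}) : bool :=
  (#|e| == 2) && (#|ban B e| <= 2).

(** Entries (v, h) of a list record a core vertex and the hyperedge that leads
    from it to the core vertex of the next entry. *)
Definition link (T : finType) (p q : T * {set T}) : bool :=
  (p.1 \in p.2) && (q.1 \in p.2).

(** The set D is there for bookkeeping: any vertex outside D is fresh. *)
Definition berge_cycle (T : finType) (B : {set {set T}}) (D : {set T})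
    (C : seq (T * {set T})) : Prop :=
  [/\ uniq (unzip1 C), uniq (unzip2 C),
      {in unzip2 C, forall h : {set T}, h \in B /\ h \subset D}
    & cycle (@link T) C].

Definition differ (T : finType) (p q : T * {set T}) : bool := p.2 != q.2.

(** The slack of 5 is 2 + 2 excluded vertices plus the one that is found. *)
Lemma thick_fresh (T : finType) (B : {set {set T}}) (e f D : {set T}) :
    thick B e -> thick B f -> e \subset D -> f \subset D -> #|D| + 5 <= #|T| ->
  exists x, [/\ x \notin D, x |: e \in B & x |: f \in B].
Proof.
case/andP=> _ be /andP[_ bf] eD fD leD.
have [x xN] : exists x, x \in ~: (D :|: (ban B e :|: ban B f)).
  apply/card_gt0P; have := cardsC (D :|: (ban B e :|: ban B f)).
  have := cardsU D (ban B e :|: ban B f).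
  by have := cardsU (ban B e) (ban B f); lia.
move: xN; rewrite !inE !negb_or !negb_and !negbK => /and3P[xD xe xf].
have xNe : x \notin e by apply: contra xD; apply/subsetP.
have xNf : x \notin f by apply: contra xD; apply/subsetP.
by exists x; split=> //; [move: xe | move: xf];
  rewrite ?(negPf xNe) ?(negPf xNf).
Qed.

Lemma setU1_inj_label (T : finType) (x : T) (e f : {set T}) :
  x \notin e -> x \notin f -> x |: e = x |: f -> e = f.
Proof. by move=> xe xf eq_xef; rewrite -(setU1K xe) eq_xef setU1K. Qed.

(** The inductive form of [weave_cycle], a path that ends on a hyperedge through
    e0 so that it can be closed up.  Every new hyperedge contains a vertex
    outside D, whereas hyperedges e + x for earlier x lie inside x |: D; this is
    what keeps all hyperedges distinct. *)
Lemma weave_path (T : finType) (B : {set {set T}}) (l : seq (T * {set T})) :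
  forall a (e e0 D : {set T}),
    {in (a, e) :: l, forall p : T * {set T},
       [/\ p.1 \in p.2, thick B p.2 & p.2 \subset D]} ->
    thick B e0 -> e0 \subset D ->
    uniq (a :: unzip1 l) -> path (@differ T) (a, e) l ->
    (last (a, e) l).2 != e0 ->
    #|D| + (size l).+1 + 4 <= #|T| ->
  exists h C (D' : {set T}),
    [/\ [/\ size ((a, h) :: C) = (size l).+1.*2, D \subset D'
          & #|D'| = #|D| + (size l).+1],
        [/\ uniq (a :: unzip1 C), uniq (h :: unzip2 C), path (@link T) (a, h) C
          & link (last (a, h) C) (last (a, h) C) /\ e0 \subset (last (a, h) C).2],
        {in a :: unzip1 C, forall v, v \in a :: unzip1 l \/ v \notin D},
        {in h :: unzip2 C, forall g : {set T},
           [/\ g \in B, g \subset D' & exists2 x, x \in g & x \notin D]}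
      & {in (a, e) :: l, forall p : T * {set T},
           exists2 g, (p.1, g) \in (a, h) :: C & p.2 \subset g}].
Proof.
elim: l => [|[a1 e1] l IHl] a e e0 D lab te0 e0D uniq_a.
  move=> _ /= ne_e0 leD; case: (lab (a, e)); rewrite ?mem_head //= => ae te eD.
  have [|x [xD xe xe0]] := thick_fresh te te0 eD e0D.
    by clear -leD; move: leD => /=; lia.
  have ax : a != x by apply: contraNneq xD => <-; apply: (subsetP eD).
  exists (x |: e), [:: (x, x |: e0)], (x |: D); split; first split=> //=.
  - by rewrite subsetU1.
  - by rewrite cardsU1 xD; lia.
  - split; rewrite /= ?inE ?andbT //.
    + apply: contra ne_e0 => /eqP /setU1_inj_label ->//; apply: contra xD.
        exact: (subsetP eD).
      exact: (subsetP e0D).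
    + by rewrite /link /= !inE eqxx ae orbT.
    + by rewrite /link /= !inE eqxx subsetU1.
  - by move=> v; rewrite /= !inE => /orP[->|/eqP->]; [left | right].
  - move=> g; rewrite !inE => /orP[] /eqP->; split; rewrite ?setUS //.
      by exists x => //; rewrite setU11.
    by exists x => //; rewrite setU11.
  - move=> p; rewrite inE => /eqP-> /=; exists (x |: e); last exact: subsetU1.
    exact: mem_head.
case/andP=> ne_e /= path_l ne_e0 leD.
have [/= ae te eD] := lab (a, e) (mem_head _ _).
have [/= ae1 te1 e1D] : [/\ a1 \in e1, thick B e1 & e1 \subset D].
  by apply: (lab (a1, e1)); rewrite !inE eqxx orbT.
have [|x [xD xe xe1]] := thick_fresh te te1 eD e1D.
    by clear -leD; move: leD => /=; lia.
have sDx := subsetU1 x D.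
have /= uniq_al := uniq_a; case/andP: uniq_al => a_l uniq_l.
have [|||h1 [C1 [D' [[szC sD' cardD'] [uC uH pC [lC e0C]] Cv Ch Cl]]]] :=
    IHl a1 e1 e0 (x |: D) _ te0 _ uniq_l path_l ne_e0.
- move=> p pl; have [|p1 p2 p3] := lab p; first by rewrite inE pl orbT.
  by split=> //; apply: subset_trans sDx.
- exact: subset_trans sDx.
- by rewrite cardsU1 xD; clear -leD; move: leD => /=; lia.
have aD : a \in D by apply: (subsetP eD).
have ax : a != x by apply: contraNneq xD => <-.
have xN : x \notin a1 :: unzip1 l.
  apply: contra xD; rewrite -[a1 :: _]/(unzip1 ((a1, e1) :: l)).
  case/mapP=> p pl ->; have [|p1 _ p3] := lab p; first by rewrite inE pl orbT.
  exact: (subsetP p3).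
have xNe : x \notin e by apply: contra xD; apply: (subsetP eD).
have xNe1 : x \notin e1 by apply: contra xD; apply: (subsetP e1D).
have old (f : {set T}) : f \subset D -> x |: f \notin h1 :: unzip2 C1.
  move=> fD; apply/negP => /Ch[_ _ [y yf]]; rewrite !inE negb_or => /andP[yx].
  by move: yf; rewrite !inE (negPf yx) /= => /(subsetP fD)->.
exists (x |: e), ((x, x |: e1) :: (a1, h1) :: C1), D'.
split; first split=> //.
- by rewrite [size _]/=; move: szC => /= ->; rewrite doubleS.
- exact: subset_trans sD'.
- by rewrite cardD' cardsU1 xD add1n addSnnS.
- split=> //.
  + change (uniq [:: a, x, a1 & unzip1 C1]); rewrite 2!cons_uniq uC andbT.
    rewrite in_cons negb_or ax [_ && _]/=.
    apply/andP; split; last first.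
      by apply/negP => /Cv[|]; [apply/negP | rewrite setU11].
    by apply/negP => /Cv[|]; [apply/negP | rewrite !inE aD orbT].
  + change (uniq [:: x |: e, x |: e1, h1 & unzip2 C1]).
    rewrite 2!cons_uniq uH andbT.
    rewrite old // andbT in_cons negb_or old // andbT.
    by apply: contra ne_e => /eqP/setU1_inj_label ->.
  + by rewrite /= pC /link /= !inE eqxx ae ae1 !orbT.
- move=> v; rewrite /= !inE => /or3P[->|/eqP->|vC]; first by left.
    by right.
  have [vl|] := Cv v vC; first by left; rewrite -in_cons vl orbT.
  by rewrite !inE negb_or => /andP[_]; right.
- have xD' : x \in D' by rewrite (subsetP sD') ?setU11.
  have sDD' := subset_trans sDx sD'.
  move=> g; rewrite /= in_cons => /orP[/eqP->|]; last first.
    rewrite in_cons => /orP[/eqP->|/Ch[gB gD' [y yg yD]]].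
      split=> //; last by exists x; rewrite ?setU11.
      by rewrite subUset sub1set xD' (subset_trans e1D).
    split=> //; exists y => //; apply: contra yD; exact: (subsetP sDx).
  split=> //; last by exists x; rewrite ?setU11.
  by rewrite subUset sub1set xD' (subset_trans eD).
- move=> p; rewrite in_cons => /orP[/eqP->|/Cl[g gC pg]].
    by exists (x |: e); [apply: mem_head | apply: subsetU1].
  by exists g => //; rewrite 2!in_cons gC !orbT.
Qed.

(** The cycle alternates between the given vertices and fresh ones; a given
    vertex is left through a hyperedge containing its label, which is where a
    further vertex can be inserted. *)
Lemma weave_cycle (T : finType) (B : {set {set T}}) (D : {set T})
    (l : seq (T * {set T})) :
    0 < size l -> uniq (unzip1 l) -> cycle (@differ T) l ->
    {in l, forall p : T * {set T},
       [/\ p.1 \in p.2, thick B p.2 & p.2 \subset D]} ->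
    #|D| + size l + 4 <= #|T| ->
  exists C (D' : {set T}),
    [/\ berge_cycle B D' C, size C = (size l).*2 /\ #|D'| = #|D| + size l,
        {in unzip1 C, forall v, v \in unzip1 l \/ v \notin D}
      & {in l, forall p : T * {set T},
           exists2 g, (p.1, g) \in C & p.2 \subset g}].
Proof.
case: l => // -[a e] l _ uniq_l; rewrite [cycle _ _]rcons_path.
case/andP=> path_l ne_e lab leD.
have [/= ae te eD] := lab (a, e) (mem_head _ _).
have [h [C [D' [[szC sD cardD'] [uC uH pC [lC eC]] Cv Ch Cl]]]] :=
  weave_path lab te eD uniq_l path_l ne_e leD.
exists ((a, h) :: C), D'; split=> //.
split=> // [g /Ch[gB gD' _] //|].
rewrite [cycle _ _]rcons_path pC /link /=; case/andP: lC => -> _.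
exact: (subsetP eC).
Qed.

(** The entry (a, h) becomes (a, z |: [set a; b]), (b, h) for a fresh z, so the
    new hyperedge contains a vertex that no old one contains. *)
Lemma berge_cycle_insert (T : finType) (B : {set {set T}}) (D : {set T})
    (C : seq (T * {set T})) (a b : T) (h : {set T}) :
    berge_cycle B D C -> (a, h) \in C -> b \in h -> b \notin unzip1 C ->
    thick B [set a; b] -> #|D| + 2 < #|T| ->
  exists C' (D' : {set T}),
    [/\ berge_cycle B D' C', size C' = (size C).+1 /\ #|D'| <= #|D| + 1,
        {subset unzip1 C' <= b :: unzip1 C}
      & forall p, p \in C -> p.1 != a -> p \in C'].
Proof.
case=> uC uH Ch cC ahC bh bC /andP[_ ban2] leD.
have [aD bD] : a \in D /\ b \in D.
  have [_ /subsetP hD] := Ch h (map_f snd ahC); split; last exact: hD.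
  apply: hD; have [i C1 rotC] := rot_to ahC.
  move: cC; rewrite -(rot_cycle i) rotC /=.
  by case: C1 {rotC} => [|? ?] /=; case/andP => /andP[].
have [z] : exists z, z \in ~: (D :|: ban B [set a; b]).
  apply/card_gt0P; have := cardsC (D :|: ban B [set a; b]).
  by have := cardsU D (ban B [set a; b]); lia.
rewrite in_setC in_setU negb_or => /andP[zD]; rewrite in_set.
have -> : z \notin [set a; b].
  by rewrite !inE negb_or; apply/andP; split; apply: contraNneq zD => ->.
rewrite negbK => zB.
have [i C1 rotC] := rot_to ahC.
have memC p : (p \in C) = (p \in (a, h) :: C1) by rewrite -rotC mem_rot.
have u1 : unzip1 ((a, h) :: C1) = rot i (unzip1 C) by rewrite -map_rot rotC.
have u2 : unzip2 ((a, h) :: C1) = rot i (unzip2 C) by rewrite -map_rot rotC.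
exists [:: (a, z |: [set a; b]), (b, h) & C1], (z |: D); split.
- split.
  + change (uniq [:: a, b & unzip1 C1]).
    have : uniq (b :: unzip1 ((a, h) :: C1)) by rewrite u1 /= mem_rot bC rot_uniq.
    rewrite /= !inE !negb_or => /andP[/andP[ba ->]] /andP[-> ->].
    by rewrite eq_sym ba.
  + change (uniq (z |: [set a; b] :: unzip2 ((a, h) :: C1))).
    rewrite cons_uniq u2 rot_uniq uH andbT mem_rot; apply: contra zD => /Ch[_].
    by move/subsetP; apply; rewrite setU11.
  + move=> g; rewrite -[unzip2 _]/(z |: [set a; b] :: unzip2 ((a, h) :: C1)).
    rewrite in_cons u2 mem_rot => /orP[/eqP->|/Ch[gB gD]].
      split=> //; apply/subsetP => v; rewrite !inE => /or3P[] /eqP->.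
      * by rewrite eqxx.
      * by rewrite aD orbT.
      * by rewrite bD orbT.
    by split=> //; apply: subset_trans gD (subsetU1 _ _).
  + move: cC; rewrite -(rot_cycle i) rotC ![cycle _ _]rcons_path /=.
    rewrite {3}/link /= !inE !eqxx !orbT /=.
    case: C1 {rotC memC u1 u2} => [|q C1] /=.
      by rewrite /link /= bh => /andP[].
    by rewrite /link /= bh => /andP[/andP[/andP[_ ->] ->] ->].
- split; last by rewrite cardsU1 zD; lia.
  by rewrite -(size_rot i C) rotC.
- move=> v; rewrite -[unzip1 _]/([:: a, b & unzip1 C1]) !inE.
  case/or3P=> [/eqP->|->|vC] //.
    by rewrite -(mem_rot i) -u1 mem_head orbT.
  by rewrite -(mem_rot i) -u1 in_cons vC !orbT.
- move=> p; rewrite memC !inE => /orP[/eqP->|->]; last by rewrite !orbT.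
  by rewrite eqxx.
Qed.

(** * Cyclic orders with distinct consecutive labels *)

(** By insertion: each label conflicts with at most one other element, which
    spoils only two of the gaps of a cycle.  The bound on the size matters:
    three elements, two of them with the same label, have no such order. *)
Lemma cyclic_order (T L : eqType) (lab : T -> L) (s : seq T) :
    3 < size s -> (forall x, count_mem x (map lab s) <= 2) ->
  exists2 t, perm_eq t s & cycle (fun u v => lab u != lab v) t.
Proof.
elim: s => // v s IHs; rewrite [size _]/= ltnS leq_eqVlt => /orP[/eqP|gt3 cnt].
  case: s {IHs} => [|b [|c [|d []]]] // _ cnt.
  have := (cnt (lab v), cnt (lab b), cnt (lab c), cnt (lab d)).
  rewrite /= !eqxx (eq_sym (lab d) (lab c)) !(eq_sym _ (lab b)) !(eq_sym _ (lab v)).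
  move=> cnts.
  have : [|| [&& lab v != lab b, lab b != lab c, lab c != lab d & lab v != lab d],
             [&& lab v != lab c, lab b != lab c, lab b != lab d & lab v != lab d]
           | [&& lab v != lab b, lab b != lab d, lab c != lab d & lab v != lab c]].
    case: cnts => [[[]]].
    do 6 case: (_ == _) => //=.
  case/or3P=> /and4P[n1 n2 n3 n4].
  - by exists [:: v; b; c; d]; rewrite //= n1 n2 n3 eq_sym n4.
  - exists [:: v; c; b; d]; last by rewrite /= n1 eq_sym n2 n3 eq_sym n4.
    by rewrite perm_cons (perm_catCA [:: c] [:: b]).
  - exists [:: v; b; d; c]; last by rewrite /= n1 n2 eq_sym n3 eq_sym n4.
    by rewrite !perm_cons (perm_catCA [:: d] [:: c] [::]).
have [|t pts cyc_t] := IHs gt3.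
  by move=> x; apply: leq_trans (cnt x); rewrite /= leq_addl.
have cnt1 : count_mem (lab v) (map lab t) <= 1.
  have := cnt (lab v); rewrite /= eqxx add1n ltnS.
  by rewrite (permP (perm_map lab pts)).
have : 3 < size t by rewrite (perm_size pts).
have pvt : perm_eq (v :: t) (v :: s) by rewrite perm_cons.
case: t {pts} pvt cyc_t cnt1 => [|u0 [|u1 [|u2 [|u3 r]]]] // pvt.
rewrite /= ![lab _ == lab v]eq_sym => /and4P[n01 n12 n23 path_r] cnt1 _.
have [e1 | n1] := eqVneq (lab v) (lab u1).
  exists [:: u0, u1, u2, v & u3 :: r].
    by rewrite -(permPr pvt) (perm_catCA [:: u0; u1; u2] [:: v]).
  have {}cnt1 : ((lab v == lab u2) || (lab v == lab u3)) = false.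
    move: cnt1; rewrite e1 eqxx.
    by do 3 case: (_ == _) => //=.
  move/negbT: cnt1; rewrite negb_or => /andP[n2 n3].
  by rewrite /= n01 n12 eq_sym n2 n3 path_r.
have [e0 | n0] := eqVneq (lab v) (lab u0).
  exists [:: u0, u1, v & u2 :: u3 :: r].
    by rewrite -(permPr pvt) (perm_catCA [:: u0; u1] [:: v]).
  have n2 : lab v != lab u2.
    move: cnt1; rewrite e0 eqxx.
    by do 3 case: (_ == _) => //=.
  by rewrite /= n01 eq_sym n1 n2 n23 path_r.
exists [:: u0, v & u1 :: u2 :: u3 :: r].
  by rewrite -(permPr pvt) (perm_catCA [:: u0] [:: v]).
by rewrite /= eq_sym n0 n1 n12 n23 path_r.
Qed.

(** * Vertex sets without isolated vertices *)

Definition isolation_free (T : finType) (e : rel T) (W : {set T}) : bool :=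
  [forall v in W, [exists u in W, e v u]].

Lemma isolation_freeP (T : finType) (e : rel T) (W : {set T}) :
  reflect {in W, forall v, exists2 u, u \in W & e v u} (isolation_free e W).
Proof.
apply: (iffP forall_inP) => [eW v vW | eW v vW].
  by have /exists_inP[u uW evu] := eW v vW; exists u.
by have [u uW evu] := eW v vW; apply/exists_inP; exists u.
Qed.

Lemma isolation_free_partner (T : finType) (e : rel T) (W : {set T}) :
  isolation_free e W ->
  exists p : T -> T, {in W, forall v, p v \in W /\ e v (p v)}.
Proof.
move/isolation_freeP=> eW.
exists (fun v => odflt v [pick u | (u \in W) && e v u]) => v vW.
case: pickP => [u /andP[]//|none]; have [u uW evu] := eW v vW.
by have := none u; rewrite /= uW evu.
Qed.

(** A missing vertex is added alone if it has a neighbour in W, together with a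
    neighbour otherwise; hence the size is only controlled up to one. *)
Lemma isolation_free_size (T : finType) (e : rel T) (A : {set T}) (j : nat) :
    symmetric e -> irreflexive e -> isolation_free e A -> j <= #|A| ->
  exists2 W : {set T}, isolation_free e W & j <= #|W| <= j.+1.
Proof.
move=> sym_e irr_e /isolation_freeP eA; elim: j => [_|j IHj ltj].
  by exists set0; rewrite ?cards0 //; apply/isolation_freeP => v; rewrite inE.
have [W eW /andP[]] := IHj (ltnW ltj).
rewrite leq_eqVlt => /orP[/eqP Wj _|]; last first.
  by move=> gtj leW; exists W; rewrite // gtj leqW.
have [v] : exists v, v \in A :\: W.
  apply/card_gt0P; have := cardsID W A; have := subset_leq_card (subsetIr A W).
  by lia.
rewrite inE => /andP[vW vA]; have [u uA evu] := eA v vA.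
move/isolation_freeP in eW.
have uv : u != v by apply: contraTneq evu => ->; rewrite irr_e.
exists (v |: (u |: W)).
  apply/isolation_freeP => w; rewrite !inE => /or3P[/eqP->|/eqP->|wW].
  - by exists u; rewrite // !inE eqxx orbT.
  - by exists v; rewrite 1?sym_e // !inE eqxx.
  - by have [x xW ewx] := eW w wW; exists x; rewrite // !inE xW !orbT.
by rewrite !cardsU1 !inE negb_or eq_sym uv vW /=; case: (u \in W); lia.
Qed.

(** If no vertex can be dropped, every v in W has a neighbour whose only
    neighbour in W is v.  Applying this twice returns to v, so the induced graph
    is a perfect matching. *)
Lemma isolation_free_shrink (T : finType) (e : rel T) (W : {set T}) :
    symmetric e -> irreflexive e -> isolation_free e W ->
  (exists2 v, v \in W & isolation_free e (W :\ v)) \/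
  (~~ odd #|W| /\
   exists p : T -> T, {in W, forall v, [/\ p v \in W, e v (p v) & p (p v) = v]}).
Proof.
move=> sym_e irr_e /isolation_freeP eW.
have [v | no_v] := pickP [pred v | (v \in W) && isolation_free e (W :\ v)].
  by case/andP; left; exists v.
right.
pose leaf v u := [&& u \in W, e v u & [forall w in W, e u w ==> (w == v)]].
have leafP v : v \in W -> exists u, leaf v u.
  move=> vW; have := no_v v; rewrite /= vW /= => /negbT/forall_inPn[u].
  rewrite !inE => /andP[uv uW] /exists_inPn noW.
  have only_v w : w \in W -> e u w -> w = v.
    move=> wW euw; apply/eqP/negPn/negP => wv.
    by have := noW w; rewrite !inE wv wW euw => /(_ isT).
  have [w wW euw] := eW u uW.
  exists u; rewrite /leaf uW sym_e -{1}(only_v w wW euw) euw.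
  by apply/forall_inP => x xW; apply/implyP => /(only_v x xW)->.
pose p v := odflt v [pick u | leaf v u].
have pleaf v : v \in W -> leaf v (p v).
  by move/leafP=> [u vu]; rewrite /p; case: pickP => // /(_ u); rewrite vu.
have pP : {in W, forall v, [/\ p v \in W, e v (p v) & p (p v) = v]}.
  move=> v vW; have /and3P[pW evp /forall_inP only_v] := pleaf v vW.
  have /and3P[ppW epp _] := pleaf _ pW.
  by split=> //; apply/eqP; apply: (implyP (only_v _ ppW)).
split; last by exists p.
pose f v := [set v; p v].
have := card_uniform_partition _ (preim_partitionP f W) => /(_ 2) ->.
  by rewrite muln2 odd_double.
move=> _ /imsetP[v vW ->]; have [pW evp pp] := pP v vW.
rewrite (_ : [set _ in _ | _] = f v).
  rewrite cards2; suff -> : v != p v by [].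
  by apply: contraTneq evp => <-; rewrite irr_e.
apply/setP => u; rewrite in_set; apply/andP/idP => [[uW /eqP->]|].
  by rewrite set21.
rewrite !inE => /orP[]/eqP->; first by rewrite eqxx.
by rewrite pW /f pp setUC eqxx.
Qed.

(** * Cycles forced by a large cover number *)

Definition thick_rel (T : finType) (B : {set {set T}}) : rel T :=
  fun u v => thick B [set u; v].

Lemma thick_rel_sym (T : finType) (B : {set {set T}}) : symmetric (thick_rel B).
Proof. by move=> u v; rewrite /thick_rel setUC. Qed.

Lemma thick_rel_irr (T : finType) (B : {set {set T}}) : irreflexive (thick_rel B).
Proof. by move=> u; rewrite /thick_rel /thick cards2 eqxx. Qed.

(** The graph of thick pairs has no vertex cover of size less than k. *)
Definition cover_number_ge (T : finType) (B : {set {set T}}) (k : nat) : Prop :=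
  forall D : {set T}, #|D| < k ->
    exists u v, [/\ thick B [set u; v], u \notin D & v \notin D].

(** Labelling every v by [set v; p v] keeps all labels inside W, so that only
    #|W| vertices are lost as fresh ones.  The vertices of W outside V remain
    available for insertion. *)
Lemma cycle_through (T : finType) (B : {set {set T}}) (W V : {set T})
    (p : T -> T) :
    {in W, forall v, p v \in W /\ thick B [set v; p v]} -> V \subset W ->
    3 < #|V| -> #|W| + #|V| + 4 <= #|T| ->
  exists C (D : {set T}),
    [/\ berge_cycle B D C, size C = #|V|.*2 /\ #|D| = #|W| + #|V|,
        {in W :\: V, forall v, v \notin unzip1 C}
      & {in V, forall v, exists2 g, (v, g) \in C & p v \in g}].
Proof.
move=> pW sVW gt3 leT; pose lab v := [set v; p v].
have [||t tV cyc_t] := @cyclic_order _ _ lab (enum V).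
- by rewrite -cardE.
- move=> x; rewrite count_map.
  have -> : count (preim lab (pred1 x)) (enum V) = #|[set v in V | lab v == x]|.
    rewrite cardE /enum_mem size_filter count_filter.
    by apply: eq_count => v; rewrite /= !inE andbC.
  have [-> | [v]] := set_0Vmem [set v in V | lab v == x]; first by rewrite cards0.
  rewrite inE => /andP[_ /eqP <-].
  apply: (@leq_trans #|lab v|); last by rewrite cards2; case: (_ != _).
  apply/subset_leq_card/subsetP => u; rewrite inE => /andP[_ /eqP <-].
  by rewrite set21.
pose l := [seq (v, lab v) | v <- t].
have l1 : unzip1 l = t by rewrite /unzip1 -map_comp map_id.
have sl : size l = #|V| by rewrite size_map (perm_size tV) -cardE.
have memt v : (v \in t) = (v \in V) by rewrite (perm_mem tV) mem_enum.
have [|||||C [D [bC [szC cardD] Cv Cl]]] := @weave_cycle T B W l.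
- by rewrite sl; lia.
- by rewrite l1 (perm_uniq tV) enum_uniq.
- by rewrite cycle_map.
- move=> _ /mapP[v vt ->] /=; rewrite memt in vt.
  have vW := subsetP sVW v vt; have [pvW tv] := pW v vW; split=> //.
    by rewrite set21.
  by rewrite subUset !sub1set vW.
- by rewrite sl.
exists C, D; rewrite -sl; split=> //.
  move=> v; rewrite inE => /andP[vV vW]; apply/negP => /Cv[|].
    by rewrite l1 memt (negPf vV).
  by rewrite vW.
move=> v vV; have [|g gC /subsetP pg] := Cl (v, lab v).
  by apply/mapP; exists v; rewrite ?memt.
by exists g => //; apply: pg; rewrite set22.
Qed.

(** All vertices but one of the support form a cover. *)
Lemma cover_number_ge_support (T : finType) (B : {set {set T}}) (k : nat) :
    0 < k -> cover_number_ge B k ->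
  exists2 A : {set T}, isolation_free (thick_rel B) A & k < #|A|.
Proof.
move=> k_gt0 hB; pose A := [set v | [exists u, thick_rel B v u]].
have memA u v : thick B [set u; v] -> u \in A.
  by move=> uv; rewrite inE; apply/existsP; exists v.
exists A.
  apply/isolation_freeP => v; rewrite inE => /existsP[u vu].
  by exists u => //; apply: (@memA u v); rewrite setUC.
rewrite ltnNge; apply/negP => leAk.
have [|x [y [/memA xA _ _]]] := hB set0; first by rewrite cards0.
have [|u [v [uv uD vD]]] := hB (A :\ x).
  by have := cardsD1 x A; rewrite xA; lia.
have := thick_rel_irr B x; rewrite /thick_rel.
have uA := memA _ _ uv; have vA : v \in A by apply: (@memA v u); rewrite setUC.
rewrite in_setD1 uA andbT negbK in uD; rewrite in_setD1 vA andbT negbK in vD.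
by rewrite -{1}(eqP uD) -(eqP vD) uv.
Qed.

Lemma set2_neq (T : finType) (a b c d : T) :
  a != c -> a != d -> [set a; b] != [set c; d].
Proof.
move=> ac ad; apply: contraNneq ac => e; have := set21 a b.
by rewrite e !inE (negPf ad) orbF.
Qed.

Lemma thick_neq (T : finType) (B : {set {set T}}) (a b : T) :
  thick B [set a; b] -> a != b.
Proof. by apply: contraTneq => ->; apply/negbT/(thick_rel_irr B). Qed.

(** For length 7 there are only three vertices to weave through, too few for
    [cyclic_order].  Choosing each pair off representatives of the earlier ones
    makes the three pairs distinct. *)
Lemma berge_cycle_seven (T : finType) (B : {set {set T}}) :
    cover_number_ge B 3 -> 12 < #|T| ->
  exists C (D : {set T}), berge_cycle B D C /\ size C = 7.
Proof.
move=> hB leT.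
have [|a [b [tab _ _]]] := hB set0; first by rewrite cards0.
have ab := thick_neq tab.
have [|c [d [tcd cab dab]]] := hB [set a; b]; first by rewrite cards2 ab.
have [u [v [tuv uac vac ub]]] : exists u v,
    [/\ thick B [set u; v], u \notin [set a; c], v \notin [set a; c] & u != b].
  have [|u [v [tuv uac vac]]] := hB [set a; c]; first by rewrite cards2; case: eqP.
  have [ub | ub] := eqVneq u b; last by exists u, v.
  by exists v, u; split; rewrite // 1?setUC // -ub eq_sym (thick_neq tuv).
rewrite !inE !negb_or in cab dab uac vac.
have [[ca cb] [da db]] := (andP cab, andP dab).
have [[ua uc] [va vc]] := (andP uac, andP vac).
pose D := [set x in [:: a; b; c; d; u; v]].
have leD : #|D| <= 6 by rewrite cardsE card_size.
have [|||||C [D' [bC [szC cardD'] Cv Cl]]] := @weave_cycle T B D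
    [:: (a, [set a; b]); (c, [set c; d]); (u, [set u; v])] => //.
- by rewrite /= !inE !negb_or (eq_sym a c) ca (eq_sym a u) ua (eq_sym c u) uc.
- by rewrite /= /differ /= andbT !set2_neq // 1?eq_sym // setUC eq_sym
    set2_neq // eq_sym.
- move=> p; rewrite !inE => /or3P[] /eqP-> /=; rewrite set21; split=> //;
    by rewrite subUset !sub1set !inE !eqxx ?orbT.
- by move: leD leT => /=; clear; lia.
have [|g agC /subsetP abg] := Cl (a, [set a; b]); first exact: mem_head.
have [|||C' [D'' [bC' [szC' _] _ _]]] := berge_cycle_insert bC agC _ _ tab.
- by apply: abg; rewrite set22.
- apply/negP => /Cv[|].
    rewrite !inE (eq_sym b a) (eq_sym b c) (eq_sym b u).
    by rewrite (negPf ab) (negPf cb) (negPf ub).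
  by rewrite !inE eqxx orbT.
- by rewrite cardD' [size _]/=; move: leD leT; clear; lia.
by exists C', D''; rewrite szC' szC.
Qed.

(** Pairwise intersecting edges form a star, which one vertex covers, or a
    triangle. *)
Lemma disjoint_or_triangle (T : finType) (B : {set {set T}}) :
    cover_number_ge B 2 ->
  (exists a b c d,
     [/\ thick B [set a; b], thick B [set c; d] & uniq [:: a; b; c; d]])
  \/ (exists a b c, [/\ thick B [set a; b], thick B [set b; c],
                       thick B [set c; a] & uniq [:: a; b; c]]).
Proof.
move=> hB.
have [|a [b [tab _ _]]] := hB set0; first by rewrite cards0.
have ab := thick_neq tab.
have disj x y u v : thick B [set x; y] -> thick B [set u; v] ->
    [&& u != x, u != y, v != x & v != y] ->
    exists a b c d,
      [/\ thick B [set a; b], thick B [set c; d] & uniq [:: a; b; c; d]].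
  move=> txy tuv /and4P[ux uy vx vy]; exists x, y, u, v; split=> //.
  rewrite /= !inE !negb_or (thick_neq txy) (thick_neq tuv) !(eq_sym x) !(eq_sym y).
  by rewrite ux uy vx vy.
(* The singleton {z} is not a cover; a pair that it misses either contains x
   or avoids both. *)
have avoid z x : (exists y, thick B [set x; y] /\ y != z) \/
                 (exists u v, thick B [set u; v] /\
                    [&& u != z, u != x, v != z & v != x]).
  have [|u [v [tuv uz vz]]] := hB [set z]; first by rewrite cards1.
  rewrite !inE in uz vz.
  have [ux|ux] := eqVneq u x; first by left; exists v; rewrite -ux.
  have [vx|vx] := eqVneq v x; first by left; exists u; rewrite setUC -vx.
  by right; exists u, v; rewrite uz ux vz vx.
have [[c [tbc ca]]|[u [v [tuv uv]]]] := avoid a b; last first.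
  by left; apply: disj tab tuv _.
have [[d [tad db]]|[u [v [tuv]]]] := avoid b a; last first.
  case/and4P=> ub ua vb va; left; apply: disj tab tuv _; exact/and4P.
have [dc|dc] := eqVneq d c.
  right; exists a, b, c; rewrite tab tbc (setUC [set c]) -{1}dc tad.
  by rewrite /= !inE negb_or ab (eq_sym a) ca (thick_neq tbc).
left; apply: disj tbc tad _.
by rewrite ab (eq_sym a) ca db dc.
Qed.

(** Nine vertices leave five outside the two pairs, of which four may be
    excluded.  If two good vertices remain, they alternate with a and c.  If
    not, all excluded vertices lie outside the two pairs, hence {a, b, d} is in
    B, and the hyperedge joining d to a spares one vertex. *)
Lemma berge_cycle_four_or_five (T : finType) (B : {set {set T}})
    (a b c d : T) (n : nat) :
    thick B [set a; b] -> thick B [set c; d] -> uniq [:: a; b; c; d] ->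
    n = 4 \/ n = 5 -> 8 < #|T| ->
  exists C (D : {set T}), berge_cycle B D C /\ size C = n.
Proof.
move=> tab tcd uniq4 n45 leT.
pose D := [set x in [:: a; b; c; d]].
have leD : #|D| <= 4 by rewrite cardsE card_size.
have [/andP[_ ban_ab] /andP[_ ban_cd]] := (tab, tcd).
have [x [y [w [xD yD [yx xab xcd ycd] w_y_d wab]]]] : exists x y w,
  [/\ x \notin D, y \notin D,
      [/\ y != x, x |: [set a; b] \in B, x |: [set c; d] \in B
        & y |: [set c; d] \in B],
      w = y \/ w = d & w |: [set a; b] \in B].
  have outside z : z \notin D -> (z \notin [set a; b]) && (z \notin [set c; d]).
    by rewrite !inE !negb_or => /and4P[-> -> -> ->].
  have ok z (e : {set T}) : z \notin e -> z \notin ban B e -> z |: e \in B.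
    by move=> ze; rewrite in_set ze negbK.
  have := cardsC (D :|: ban B [set a; b] :|: ban B [set c; d]).
  have := cardsU (D :|: ban B [set a; b]) (ban B [set c; d]).
  have := cardsU D (ban B [set a; b]).
  set X := ~: _ => cardDab cardDabcd cardX.
  have XP z : z \in X ->
      [/\ z \notin D, z |: [set a; b] \in B & z |: [set c; d] \in B].
    rewrite in_setC !in_setU !negb_or => /andP[/andP[zD zab] zcd].
    by have /andP[z1 z2] := outside z zD; split=> //; apply: ok.
  have [/card_gt1P[x [y [/XP[xD xab xcd] /XP[yD yab ycd] xy]]] | leX] := ltnP 1 #|X|.
    by exists x, y, y; split; rewrite // 1?[y == x]eq_sym; auto.
  have dab : d \notin ban B [set a; b].
    apply/negP => dab; have : 0 < #|D :&: ban B [set a; b]|.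
      by apply/card_gt0P; exists d; rewrite in_setI dab !inE eqxx !orbT.
    by move: cardDab cardDabcd cardX leX leD ban_ab ban_cd leT; clear; lia.
  have /card_gt0P[x /XP[xD xab xcd]] : 0 < #|X|.
    by move: cardDab cardDabcd cardX leD ban_ab ban_cd leT; clear; lia.
  have /card_gt0P[y] : 0 < #|~: (x |: (D :|: ban B [set c; d]))|.
    have := cardsC (x |: (D :|: ban B [set c; d])).
    have := cardsU D (ban B [set c; d]); rewrite cardsU1.
    by move: leD ban_cd leT; clear; case: (_ \notin _); lia.
  rewrite in_setC in_setU1 in_setU !negb_or => /and3P[yx yD ycd].
  have /andP[_ y2] := outside y yD.
  exists x, y, d; split; [by []| by [] | split=> //; exact: ok | by right |].
  apply: ok dab; move: uniq4; rewrite /= !inE !negb_or.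
  by case/and4P=> /and3P[_ _ ad] /andP[_ bd] _ _; rewrite ![d == _]eq_sym ad.
have := uniq4; rewrite /= !inE !negb_or.
case/and4P=> /and3P[nab nac nad] /andP[nbc nbd] ncd _.
have [[xa xb xc xd] [ya yb yc yd]] :
    ([/\ x != a, x != b, x != c & x != d]
       * [/\ y != a, y != b, y != c & y != d])%type.
  by move: xD yD; rewrite !inE !negb_or => /and4P[? ? ? ?] /and4P[].
have [wa wb wc wx] : [/\ w != a, w != b, w != c & w != x].
  by case: w_y_d => ->; rewrite // ![d == _]eq_sym.
pose C := [:: (a, x |: [set a; b]); (x, x |: [set c; d]); (c, y |: [set c; d]);
             (w, w |: [set a; b])].
pose E := x |: (y |: D).
have bC : berge_cycle B E C.
  have xE : x \in E by rewrite setU11.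
  have yE : y \in E by rewrite setU1r ?setU11.
  have DE : D \subset E by rewrite /E setUA subsetUr.
  split.
  - rewrite /= !inE !negb_or xc (eq_sym a x) xa nac (eq_sym a w) wa.
    by rewrite (eq_sym x w) wx (eq_sym c w) wc.
  - have mem_neq (v : T) (g h : {set T}) : v \in g -> v \notin h -> g != h.
      by move=> vg; apply: contraNneq => <-.
    rewrite /= !in_cons !in_nil !negb_or !andbT; apply/and3P; split.
    + apply/and3P; split.
      * apply: (mem_neq a); rewrite !inE ?eqxx ?orbT // ![a == _]eq_sym.
        by rewrite !negb_or xa (eq_sym c) (eq_sym d) nac.
      * apply: (mem_neq a); rewrite !inE ?eqxx ?orbT // ![a == _]eq_sym.
        by rewrite !negb_or ya (eq_sym c) (eq_sym d) nac.
      * apply: (mem_neq x); rewrite !inE ?eqxx ?orbT // (eq_sym x w).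
        by rewrite !negb_or wx xa.
    + apply/andP; split.
      * apply: (mem_neq x); rewrite !inE ?eqxx ?orbT // (eq_sym x y).
        by rewrite !negb_or yx xc.
      * apply: (mem_neq x); rewrite !inE ?eqxx ?orbT // (eq_sym x w).
        by rewrite !negb_or wx xa.
    + apply: (mem_neq c); rewrite !inE ?eqxx ?orbT // ![c == _]eq_sym.
      by rewrite !negb_or wc nac.
  - have wE : w \in E.
      by case: w_y_d => -> //; rewrite (subsetP DE) // !inE eqxx !orbT.
    have [aE bE cE dE] : [/\ a \in E, b \in E, c \in E & d \in E].
      by split; rewrite (subsetP DE) // !inE eqxx ?orbT.
    by move=> g; rewrite !inE => /or4P[] /eqP->; split=> //;
      rewrite !subUset !sub1set ?xE ?yE ?wE ?aE ?bE ?cE ?dE.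
  - rewrite /= /link /= !inE !eqxx !orbT /= andbT.
    by case: w_y_d => ->; rewrite eqxx ?orbT.
case: n45 => ->; first by exists C, E.
have [|||C' [E' [bC' [szC' _] _ _]]] := berge_cycle_insert bC (mem_head _ _) _ _ tab.
- by rewrite !inE eqxx !orbT.
- by rewrite /= !inE !negb_or ![b == _]eq_sym nab xb (eq_sym c) nbc.
- rewrite /E !cardsU1; move: leD leT; clear.
  by do 2 case: (_ \notin _); lia.
by exists C', E'; rewrite szC'.
Qed.

Lemma short_berge_cycle (T : finType) (B : {set {set T}}) (n : nat) :
    cover_number_ge B 2 -> 8 < #|T| -> n = 4 \/ n = 5 \/ n = 6 /\ 9 < #|T| ->
  exists C (D : {set T}), berge_cycle B D C /\ size C = n.
Proof.
move=> hB leT nP.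
case: (disjoint_or_triangle hB) => [[a [b [c [d [tab tcd uniq4]]]]]|].
  case: nP => [n4 | [n5 | [n6 gt9]]].
  - by apply: berge_cycle_four_or_five tab tcd uniq4 _ leT; left.
  - by apply: berge_cycle_four_or_five tab tcd uniq4 _ leT; right.
  pose D := [set x in [:: a; b; c; d]].
  have leD : #|D| <= 4 by rewrite cardsE card_size.
  have := uniq4; rewrite /= !inE !negb_or.
  case/and4P=> /and3P[ab ac ad] /andP[bc bd] cd _.
  have [|||||C [D1 [bC [szC cardD1] Cv Cl]]] := @weave_cycle T B D
    [:: (a, [set a; b]); (c, [set c; d])] => //.
  - by rewrite /= inE ac.
  - by rewrite /= /differ /= andbT !set2_neq // eq_sym // eq_sym.
  - move=> p; rewrite !inE => /orP[] /eqP-> /=; rewrite set21; split=> //;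
      by rewrite subUset !sub1set !inE !eqxx ?orbT.
  - by rewrite [size _]/=; move: leD gt9; clear; lia.
  have [|g agC /subsetP abg] := Cl (a, [set a; b]); first exact: mem_head.
  have [|h chC /subsetP cdh] := Cl (c, [set c; d]); first by rewrite !inE eqxx orbT.
  have bC0 : b \notin unzip1 C.
    apply/negP => /Cv[|]; rewrite !inE ?eqxx ?orbT //.
    by rewrite eq_sym (negPf ab) (negPf bc).
  have dC0 : d \notin unzip1 C.
    apply/negP => /Cv[|]; rewrite !inE ?eqxx ?orbT //.
    by rewrite ![d == _]eq_sym (negPf ad) (negPf cd).
  have [||C1 [D2 [bC1 [szC1 cardD2] C1v C1p]]] :=
      berge_cycle_insert bC agC _ bC0 tab.
  - by apply: abg; rewrite set22.
  - by rewrite cardD1 [size _]/=; move: leD gt9; clear; lia.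
  have chC1 : (c, h) \in C1 by apply: C1p; rewrite //= eq_sym.
  have [|||C2 [D3 [bC2 [szC2 _] _ _]]] := berge_cycle_insert bC1 chC1 _ _ tcd.
  - by apply: cdh; rewrite set22.
  - by apply: contra dC0 => /C1v; rewrite in_cons eq_sym (negPf bd).
  - by move: cardD2; rewrite cardD1 [size _]/=; move: leD gt9; clear; lia.
  by exists C2, D3; rewrite szC2 szC1 szC n6.
case=> a [b [c [tab tbc tca uniq3]]].
have := uniq3; rewrite /= !inE !negb_or => /and3P[/andP[ab ac] bc _].
pose D := [set x in [:: a; b; c]].
have leD : #|D| <= 3 by rewrite cardsE card_size.
have [[n6 gt9] | n45] : n = 6 /\ 9 < #|T| \/ n = 4 \/ n = 5.
- by case: nP => [|[|]]; auto.
- have [|||||C [D1 [bC [szC cardD1] Cv Cl]]] := @weave_cycle T B D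
    [:: (a, [set a; b]); (b, [set b; c]); (c, [set c; a])] => //.
  + by rewrite /= /differ /= andbT !set2_neq // eq_sym.
  + move=> p; rewrite !inE => /or3P[] /eqP-> /=; rewrite set21; split=> //;
      by rewrite subUset !sub1set !inE !eqxx ?orbT.
  + by rewrite [size _]/=; move: leD gt9; clear; lia.
  by exists C, D1; rewrite szC n6.
have tba : thick B [set b; a] by rewrite setUC.
have [|||||C [D1 [bC [szC cardD1] Cv Cl]]] := @weave_cycle T B D
  [:: (b, [set b; a]); (c, [set c; a])] => //.
- by rewrite /= inE bc.
- by rewrite /= /differ /= andbT !set2_neq // eq_sym.
- move=> p; rewrite !inE => /orP[] /eqP-> /=; rewrite set21; split=> //;
    by rewrite subUset !sub1set !inE !eqxx ?orbT.
- by rewrite [size _]/=; move: leD leT; clear; lia.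
case: n45 => [n4 | n5]; first by exists C, D1; rewrite szC n4.
have [|g bgC /subsetP bag] := Cl (b, [set b; a]); first exact: mem_head.
have [|||C1 [D2 [bC1 [szC1 _] _ _]]] := berge_cycle_insert bC bgC _ _ tba.
- by apply: bag; rewrite set22.
- apply/negP => /Cv[|]; rewrite !inE ?eqxx ?orbT //.
  by rewrite (negPf ab) (negPf ac).
- by rewrite cardD1 [size _]/=; move: leD leT; clear; lia.
by exists C1, D2; rewrite szC1 szC n5.
Qed.

(** For n = 2 k + 2 the cycle weaves through k + 1 vertices, or through k with
    two insertions; for n = 2 k + 1 it weaves through k with one insertion.  The
    count of fresh vertices is tight for k = 5 and n = m = 11, where a set W of
    size k + 2 would not do; the matching case avoids it because k is even there. *)
Lemma long_berge_cycle (T : finType) (B : {set {set T}}) (k m n : nat) :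
    2 < k -> n = k.*2.+1 \/ n = k.*2.+2 -> n <= m -> 10 < m ->
    m + k <= #|T|.+1 -> cover_number_ge B k ->
  exists C (D : {set T}), berge_cycle B D C /\ size C = n.
Proof.
move=> k_gt2 nk nm m_gt10 leT hB.
have sym_e := thick_rel_sym B; have irr_e := thick_rel_irr B.
have [n7 | n7] := eqVneq n 7.
  have k3 : k = 3 by lia.
  rewrite n7; apply: berge_cycle_seven; first by rewrite -k3.
  by lia.
have [A freeA ltkA] := cover_number_ge_support (ltnW (ltnW k_gt2)) hB.
have [W freeW leW] := isolation_free_size sym_e irr_e freeA ltkA.
have partner_neq (p : T -> T) v : thick B [set v; p v] -> p v != v.
  by move=> tv; apply: contraTneq (tv) => ->; apply/negbT/thick_rel_irr.
have tight (V : {set T}) : isolation_free (thick_rel B) V -> #|V| = k.+1 ->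
    exists C (D : {set T}), berge_cycle B D C /\ size C = n.
  move=> /isolation_free_partner[p pV] cardV.
  case: nk => nk; last first.
    have [||C [D [bC [szC _] _ _]]] := cycle_through pV (subxx V).
    - by rewrite cardV.
    - by rewrite cardV; lia.
    by exists C, D; rewrite szC cardV doubleS.
  have [v vV] : exists v, v \in V by apply/card_gt0P; rewrite cardV.
  have [pvV tv] := pV v vV; have pv := partner_neq p v tv.
  have cardV' : #|V :\ p v| = k by have := cardsD1 (p v) V; rewrite pvV cardV; lia.
  have [||C [D [bC [szC cardD] Cv Cp]]] := cycle_through pV (subsetDl V [set p v]).
  - by rewrite cardV'; lia.
  - by rewrite cardV cardV'; lia.
  have [|g vgC pg] := Cp v; first by rewrite in_setD1 eq_sym pv.
  have [||C' [D' [bC' [szC' _] _ _]]] := berge_cycle_insert bC vgC pg _ tv.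
  - by apply: Cv; rewrite !inE pvV eqxx.
  - by rewrite cardD cardV cardV'; clear - nk nm m_gt10 leT k_gt2; lia.
  by exists C', D'; rewrite szC' szC cardV'.
have [Wk | Wk] := eqVneq #|W| k.+1; first exact: tight freeW Wk.
have {leW}Wk : #|W| = k.+2 by lia.
have [[v vW freeWv]|[evenW [p pW]]] := isolation_free_shrink sym_e irr_e freeW.
  apply: tight freeWv _; have := cardsD1 v W; rewrite vW Wk; lia.
have {evenW}k_even : ~~ odd k by move: evenW; rewrite Wk /= negbK.
have k_gt3 : 3 < k by rewrite ltn_neqAle k_gt2 andbT; apply: contraNneq k_even => <-.
have k_neq5 : k != 5 by apply: contraNneq k_even => ->.
have pW' : {in W, forall v, p v \in W /\ thick B [set v; p v]}.
  by move=> v /pW[].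
have neq_p v : v \in W -> p v != v by move/pW'=> [_ /partner_neq].
have [a aW] : exists a, a \in W by apply/card_gt0P; rewrite Wk.
have [paW ta ppa] := pW a aW.
have [b] : exists b, b \in W :\ a :\ p a.
  apply/card_gt0P; have := cardsD1 a W; have := cardsD1 (p a) (W :\ a).
  by rewrite aW in_setD1 paW neq_p // Wk; lia.
rewrite !in_setD1 => /and3P[b_pa b_a bW].
have [pbW tb ppb] := pW b bW.
have pb_a : p b != a by apply: contraNneq b_pa => <-; rewrite ppb.
have pb_pa : p b != p a by apply: contraNneq b_a => e; rewrite -ppb e ppa.
pose V := W :\ p a :\ p b.
have sVW : V \subset W by apply: subset_trans (subsetDl _ _) (subsetDl _ _).
have cardV : #|V| = k.
  have := cardsD1 (p a) W; have := cardsD1 (p b) (W :\ p a).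
  by rewrite in_setD1 pb_pa pbW paW Wk -/V; clear; lia.
have aV : a \in V by rewrite !in_setD1 aW !(eq_sym a) pb_a neq_p.
have bV : b \in V by rewrite !in_setD1 bW b_pa eq_sym neq_p.
(* With k = 5 and n = m = 11 there would be one vertex too few. *)
have leWV : #|W| + #|V| + 4 <= #|T|.
  by rewrite Wk cardV; clear - nk nm m_gt10 leT k_gt3 k_neq5; lia.
have [|C [D [bC [szC cardD] Cv Cp]]] := cycle_through pW' sVW _ leWV.
  by rewrite cardV.
have [g agC pg] := Cp a aV; have [h bhC ph] := Cp b bV.
have paC : p a \notin unzip1 C by apply: Cv; rewrite in_setD paW !in_setD1 eqxx andbF.
have pbC : p b \notin unzip1 C by apply: Cv; rewrite in_setD pbW !in_setD1 eqxx.
have [|C1 [D1 [bC1 [szC1 cardD1] C1v C1p]]] := berge_cycle_insert bC agC pg paC ta.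
  by rewrite cardD Wk cardV; clear - nk nm m_gt10 leT k_gt3 k_neq5; lia.
case: nk => nk; first by exists C1, D1; rewrite szC1 szC cardV.
have bhC1 : (b, h) \in C1 by apply: C1p.
have [||C2 [D2 [bC2 [szC2 _] _ _]]] := berge_cycle_insert bC1 bhC1 ph _ tb.
- by apply: contra pbC => /C1v; rewrite in_cons (negPf pb_pa).
- by move: cardD1; rewrite cardD Wk cardV; clear - nk nm m_gt10 leT k_gt3 k_neq5; lia.
by exists C2, D2; rewrite szC2 szC1 szC cardV.
Qed.

(** * From vertex and hyperedge assignments to monochromatic copies *)

(** For n = 2 the two edges {i, i + 1} coincide. *)
Lemma cycle_edge_inj (n : nat) (i j : 'I_n) :
  2 < n -> [set i; ordS i] = [set j; ordS j] -> i = j.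
Proof.
move=> n_gt2 eq_ij.
have : i \in [set j; ordS j] by rewrite -eq_ij set21.
rewrite !inE => /orP[/eqP //|/eqP i_Sj].
have : j \in [set i; ordS i] by rewrite eq_ij set21.
rewrite !inE => /orP[/eqP //|/eqP j_Si].
have /(congr1 val) := i_Sj; have /(congr1 val) := j_Si; rewrite /=.
have [li lj] := (ltn_ord i, ltn_ord j).
have [ei | ei] := eqVneq i.+1 n; have [ej | ej] := eqVneq j.+1 n.
- by rewrite ei ej modnn; move: n_gt2 li lj ei ej; lia.
- rewrite ei modnn (@modn_small j.+1); last by move: lj ej; lia.
  by move: n_gt2 li lj ei ej; lia.
- rewrite ej modnn (@modn_small i.+1); last by move: li ei; lia.
  by move: n_gt2 li lj ei ej; lia.
- rewrite !modn_small; [|by move: lj ej; lia|by move: li ei; lia].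
  by move: n_gt2 li lj ei ej; lia.
Qed.

Lemma cycle_nth (T : Type) (e : rel T) (x0 : T) (s : seq T) (i : nat) :
  cycle e s -> i < size s -> e (nth x0 s i) (nth x0 s (i.+1 %% size s)).
Proof.
case: s => // x s /= /(pathP x0) es lti.
have := es i; rewrite size_rcons => /(_ lti).
rewrite (_ : nth x0 (rcons s x) i = nth x0 (x :: s) (i.+1 %% (size s).+1)).
  by rewrite -rcons_cons nth_rcons /= lti.
move: lti; rewrite ltnS leq_eqVlt nth_rcons => /orP[/eqP->|lti].
  by rewrite ltnn eqxx modnn.
by rewrite lti modn_small.
Qed.

(** The assignment Phi names the hyperedges directly inside the vertex set of
    the complete hypergraph, so the copy is embedded by the identity. *)
Lemma mono_berge (N r t : nat) (c : {set 'I_N} -> 'I_t) (i : 'I_t)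
    (G : set_system) (f : vertex G -> 'I_N)
    (Phi : {set vertex G} -> {set 'I_N}) :
    0 < r -> 0 < N -> injective f -> {in edges G &, injective Phi} ->
    {in edges G, forall e : {set vertex G},
       [/\ f @: e \subset Phi e, #|Phi e| = r & c (Phi e) = i]} ->
  exists H, berge r G H /\ @mono_copy t (complete r N) c i H.
Proof.
move=> r0 N0 injf injPhi PhiP.
exists (@SetSystem 'I_N (Phi @: edges G)); split.
  split.
  - rewrite /is_hypergraph /= card_ord N0 /=; apply/imsetP => -[e eG Phi0].
    by have [_] := PhiP e eG; rewrite -Phi0 cards0 => e0; rewrite -e0 in r0.
  - apply/forall_inP => h /imsetP[e eG ->]; apply/eqP.
    by have [_] := PhiP e eG.
  - by exists f, Phi; split=> // e eG; have [] := PhiP e eG.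
exists id; split=> // h /imsetP[e eG ->]; rewrite imset_id.
by have [_ ? ?] := PhiP e eG; split=> //; rewrite inE; apply/eqP.
Qed.

Lemma mono_berge_cycle (N : nat) (c : {set 'I_N} -> 'I_2) (i : 'I_2)
    (B : {set {set 'I_N}}) (D : {set 'I_N}) (C : seq ('I_N * {set 'I_N})) :
    {in B, forall h : {set 'I_N}, #|h| = 3 /\ c h = i} ->
    2 < size C -> berge_cycle B D C ->
  exists H,
    berge 3 (cycle_graph (size C)) H /\ @mono_copy 2 (complete 3 N) c i H.
Proof.
move=> BP; set n := size C => n_gt2 [uC uH Ch cC].
have [p0 p0C] : exists p, p \in C.
  by move: n_gt2; rewrite /n; case: (C) => // p ? _; exists p; rewrite mem_head.
pose v (j : 'I_n) := (nth p0 C j).1; pose g (j : 'I_n) := (nth p0 C j).2.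
have injv : injective v.
  move=> j k; rewrite /v -!(nth_map p0 p0.1) // => /eqP.
  by rewrite nth_uniq ?size_map // => /eqP/val_inj.
have injg : injective g.
  move=> j k; rewrite /g -!(nth_map p0 p0.2) // => /eqP.
  by rewrite nth_uniq ?size_map // => /eqP/val_inj.
pose Phi (e : {set 'I_n}) :=
  if [pick j | e == [set j; ordS j]] is Some j then g j else set0.
have PhiE j : Phi [set j; ordS j] = g j.
  rewrite /Phi; case: pickP => [k /eqP/(cycle_edge_inj n_gt2)-> //|/(_ j)].
  by rewrite eqxx.
apply: (@mono_berge N 3 2 c i (cycle_graph n) v Phi) => //.
- exact: leq_ltn_trans (ltn_ord p0.1).
- move=> _ _ /imsetP[j _ ->] /imsetP[k _ ->].
  by rewrite !PhiE => /injg ->.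
- move=> _ /imsetP[j _ ->]; rewrite PhiE.
  have gC : g j \in unzip2 C by apply: map_f; apply: mem_nth.
  have [gB _] := Ch _ gC; have [? ?] := BP _ gB; split=> //.
  have /andP[vj vSj] : link (nth p0 C j) (nth p0 C (ordS j)) by apply: cycle_nth.
  by apply/subsetP => _ /imsetP[k kj ->]; move: kj; rewrite !inE => /orP[]/eqP->.
Qed.

Lemma mono_berge_clique (N m : nat) (c : {set 'I_N} -> 'I_2) (i : 'I_2)
    (S : {set 'I_N}) :
    1 < m <= #|S| ->
    (forall e : {set 'I_N}, e \subset S -> #|e| = 2 ->
       3 <= #|[set h : {set 'I_N} | [&& #|h| == 3, c h == i & e \subset h]]|) ->
  exists H, berge 3 (complete_graph m) H /\ @mono_copy 2 (complete 3 N) c i H.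
Proof.
case/andP=> m_gt1 leS deg.
pose R := [set h : {set 'I_N} | (#|h| == 3) && (c h == i)].
have [||F injF FP] := @berge_clique_assignment _ R S.
- by move=> h; rewrite inE => /andP[/eqP].
- move=> e eS e2; apply: leq_trans (deg e eS e2) _.
  by apply/subset_leq_card/subsetP => h; rewrite !inE andbA.
pose f (j : 'I_m) : 'I_N := enum_val (widen_ord leS j).
have injf : injective f by move=> j k /enum_val_inj /(congr1 val) /= /val_inj.
have fP (e : {set 'I_m}) : e \in edges (complete_graph m) ->
    f @: e \in [set e : {set 'I_N} | e \subset S & #|e| == 2].
  rewrite !inE card_imset // => ->; rewrite andbT.
  by apply/subsetP => _ /imsetP[j _ ->]; apply: enum_valP.
apply: (@mono_berge N 3 2 c i (complete_graph m) f (fun e => F (f @: e))) => //.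
- apply: leq_trans (ltnW m_gt1) (leq_trans leS _).
  by rewrite -[N in _ <= N]card_ord max_card.
- move=> e e' eG e'G /(injF _ _ (fP e eG) (fP e' e'G)).
  exact: (imset_inj injf).
- move=> e /fP; rewrite inE => /andP[eS /eqP e2].
  by have [] := FP _ eS e2; rewrite inE => /andP[/eqP ? /eqP ?].
Qed.

(** * The lower bound *)

Lemma card_ord_interval (M p q : nat) :
  #|[set i : 'I_M | p <= i < q]| <= q - p.
Proof.
rewrite cardE -(size_map val) -(size_iota p (q - p)).
apply: uniq_leq_size => [|x /mapP[i]].
  by rewrite (map_inj_uniq val_inj) enum_uniq.
by rewrite mem_enum inE mem_iota => /andP[pi iq] -> /=; lia.
Qed.

(** The colouring gives the cycle colour to the triples with at least two
    vertices in a set A of size a. *)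
Lemma two_heavy_colouring (n m a M : nat) :
    3 < n -> 1 < m -> 2 * a < n \/ n = 4 /\ a = 2 -> M <= m - 2 + a ->
  ~ ramsey_property 3
      (pair_families (berge 3 (complete_graph m)) (berge 3 (cycle_graph n))) M.
Proof.
move=> n_gt3 m_gt1 an leM.
pose A := [set i : 'I_M | i < a].
have cardA : #|A| <= a by rewrite (leq_trans (card_ord_interval M 0 a)) ?subn0.
have cardA' : #|~: A| <= m - 2.
  have -> : ~: A = [set i : 'I_M | a <= i < M].
    by apply/setP => i; rewrite !inE ltn_ord andbT -leqNgt.
  by apply: leq_trans (card_ord_interval M a M) _; lia.
move/(_ (fun h : {set 'I_M} => if 1 < #|h :&: A| then ord_max else ord0)).
case=> i [H]; rewrite /pair_families; case: eqP => [-> | ne_i0] [].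
  case=> _ _ [iota [Phi [inji injPhi PhiE Phi_sub]]] [f [injf fP]].
  have injfi := inj_comp injf inji.
  pose J : {set 'I_m} := [set j | f (iota j) \in A].
  have : 1 < #|J|.
    have := cardsC J; rewrite card_ord.
    suff : #|~: J| <= #|~: A| by move: m_gt1 cardA'; clear; lia.
    rewrite -(card_imset _ injfi); apply/subset_leq_card/subsetP => x.
    by case/imsetP=> j; rewrite !inE => jA ->.
  case/card_gt1P=> u [v [uA vA uv]].
  have eG : [set u; v] \in edges (complete_graph m) by rewrite inE cards2 uv.
  have [] := fP (Phi [set u; v]); first by rewrite -PhiE imset_f.
  move=> _; case: ifP => [_ /(congr1 val) // | /negP nA _]; apply: nA.
  apply/card_gt1P; exists (f (iota u)), (f (iota v)).
  rewrite !inE in uA vA; rewrite !inE uA vA !andbT.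
  have sub := subsetP (Phi_sub _ eG).
  split; last by rewrite (inj_eq injfi).
  - by apply/imset_f/sub/imset_f; rewrite set21.
  - by apply/imset_f/sub/imset_f; rewrite set22.
case=> _ /forall_inP uni [iota [Phi [inji injPhi PhiE Phi_sub]]] [f [injf fP]].
have injfi := inj_comp injf inji.
pose g (j : 'I_n) : 'I_M := f (iota j).
pose E (j : 'I_n) : {set 'I_M} := f @: Phi [set j; ordS j].
have eG (j : 'I_n) : [set j; ordS j] \in edges (cycle_graph n)
  by apply/imsetP; exists j.
have PhiH j : Phi [set j; ordS j] \in edges H by rewrite -PhiE imset_f ?eG.
have E3 j : #|E j| = 3 by rewrite card_imset //; apply/eqP/uni.
have EA j : 1 < #|E j :&: A|.
  have [_] := fP _ (PhiH j).
  by case: ifP => // _ i0; case: ne_i0; rewrite -i0.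
have injE : injective E.
  move=> j k /(imset_inj injf) /injPhi e; apply: cycle_edge_inj (e _ _) => //.
  exact: ltnW.
have gE j : g j \in E j /\ g (ordS j) \in E j.
  have sub := subsetP (Phi_sub _ (eG j)).
  by split; apply/imset_f/sub/imset_f; rewrite ?set21 ?set22.
pose I : {set 'I_n} := [set j | g j \in A].
have cardI : #|I| <= #|A|.
  rewrite -(card_imset _ injfi); apply/subset_leq_card/subsetP => x.
  by case/imsetP=> j; rewrite !inE => jA ->.
have [lt_an | [n4 a2]] := an.
  suff : #|[set: 'I_n]| <= #|I| + #|I| by rewrite cardsT card_ord; lia.
  have := cardsU I (@ordS n @^-1: I).
  rewrite (card_preimset I (can_inj (@ordSK n))).
  suff <- : [set: 'I_n] = I :|: @ordS n @^-1: I by lia.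
  apply/setP => j; rewrite !inE; apply/esym; apply: contraTT (EA j).
  rewrite negb_or => /andP[jA SjA]; rewrite -leqNgt.
  have [gj gSj] := gE j.
  have : E j :&: A \subset E j :\ g j :\ g (ordS j).
    apply/subsetP => x; rewrite in_setI => /andP[xE xA]; rewrite !in_setD1 xE andbT.
    by apply/andP; split; apply: contraTneq xA => ->; rewrite inE.
  move/subset_leq_card/leq_trans; apply.
  have := cardsD1 (g (ordS j)) (E j :\ g j); have := cardsD1 (g j) (E j).
  rewrite E3 gj in_setD1 gSj (inj_eq injfi).
  have -> : ordS j != j.
    apply/eqP => /(congr1 val) /=; have := ltn_ord j.
    have [ej|ej] := eqVneq j.+1 n; first by rewrite ej modnn; lia.
    by move=> ltj; rewrite modn_small; lia.
  by move=> e1 e2; move: e1; rewrite e2 !add1n => -[<-].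
have [j jA] : exists j, j \notin I.
  have : #|~: I| > 0 by have := cardsC I; rewrite card_ord; lia.
  by case/card_gt0P => j; rewrite inE; exists j.
(* Now n = 4 and a = 2: every hyperedge through a vertex outside A consists of
   that vertex and A, so the two hyperedges at such a cycle vertex coincide. *)
have EE k k' : g k' \in E k -> k' \notin I -> E k = g k' |: A.
  move=> gEk k'I; have gA : g k' \notin A by move: k'I; rewrite !inE.
  have sAE : E k :&: A = A.
    by apply/eqP; rewrite eqEcard subsetIr (leq_trans cardA) ?a2 ?EA.
  apply/esym/eqP; rewrite eqEcard E3 cardsU1 gA.
  by rewrite subUset sub1set gEk -{1}sAE subsetIl; move: (EA k); rewrite sAE.
have gEj : g j \in E (ord_pred j).
  by have [_] := gE (ord_pred j); rewrite ord_predK.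
have : j = ord_pred j.
  by apply: injE; rewrite (EE _ _ (gE j).1 jA) (EE _ _ gEj jA).
move/(congr1 val) => /=; have := ltn_ord j.
have [j0 | j0] := posnP j; first by rewrite j0 add0n modn_small; lia.
move=> ltj; rewrite (_ : (j + n).-1 = j.-1 + n); last by lia.
by rewrite modnDr modn_small; lia.
Qed.

(** * The upper bound and the Ramsey numbers *)

(** A small cover D of the thick pairs leaves the vertices outside D pairwise
    not thick, hence each pair in at least three triples of the clique colour. *)
Lemma cover_number_ge_or_clique (N m k : nat) (c : {set 'I_N} -> 'I_2) :
    1 < m -> m + k <= N.+1 ->
  cover_number_ge [set h : {set 'I_N} | (#|h| == 3) && (c h == ord_max)] k \/
  exists H,
    berge 3 (complete_graph m) H /\ @mono_copy 2 (complete 3 N) c ord0 H.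
Proof.
move=> m_gt1 leN; set B := [set h | _].
have [D /andP[ltD noD] | hB] := pickP [pred D : {set 'I_N} | (#|D| < k) &&
    [forall u, forall v, (u \notin D) && (v \notin D) ==> ~~ thick B [set u; v]]];
  last first.
  left=> D ltD; have := hB D.
  rewrite /= ltD /= => /negbT/forallPn[u /forallPn[v]].
  by rewrite negb_imply negbK => /andP[/andP[uD vD] tuv]; exists u, v.
right; apply: (@mono_berge_clique N m c ord0 (~: D)).
  by have := cardsC D; rewrite card_ord m_gt1; move: ltD leN; clear; lia.
move=> e eD e2; have /cards2P[u [v [uv euv]]] : #|e| == 2 by apply/eqP.
have /implyP := forallP (forallP noD u) v.
have uD : u \notin D by rewrite -in_setC (subsetP eD) // euv set21.
have vD : v \notin D by rewrite -in_setC (subsetP eD) // euv set22.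
rewrite uD vD -euv => /(_ isT); rewrite /thick e2 eqxx /= -ltnNge => ltban.
apply: leq_trans ltban _.
rewrite -(@card_in_imset _ _ (fun x => x |: e) (ban B e)).
  apply/subset_leq_card/subsetP => _ /imsetP[x xban ->].
  move: xban; rewrite !inE => /andP[xe].
  rewrite cardsU1 xe e2 subsetUr /= andbT -val_eqE -[c _ == ord0]val_eqE /=.
  by case: (c _) => [[|[|]]].
move=> x y; rewrite !in_set => /andP[xe _] /andP[ye _] exy.
have : x \in y |: e by rewrite -exy setU11.
by rewrite in_setU1 (negPf xe) orbF => /eqP.
Qed.

Lemma ramsey_property_upper (N m n k : nat) :
    1 < m -> m + k <= N.+1 -> 2 < n ->
    (forall B : {set {set 'I_N}}, cover_number_ge B k ->
       exists C (D : {set 'I_N}), berge_cycle B D C /\ size C = n) ->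
  ramsey_property 3
    (pair_families (berge 3 (complete_graph m)) (berge 3 (cycle_graph n))) N.
Proof.
move=> m_gt1 leN n_gt2 cyc c.
have [hB | [H cH]] := cover_number_ge_or_clique c m_gt1 leN; last by exists ord0, H.
have [C [D [bC szC]]] := cyc _ hB; rewrite -szC in n_gt2.
have [|H cH] := @mono_berge_cycle N c ord_max _ D C _ n_gt2 bC.
  by move=> h; rewrite inE => /andP[/eqP ? /eqP].
by exists ord_max, H; rewrite -szC.
Qed.

Theorem theorem5 :
  (forall n m : nat, n = 4 \/ n = 5 -> 8 <= m ->
     is_ramsey_number 3
       (pair_families (berge 3 (complete_graph m)) (berge 3 (cycle_graph n)))
       (m + 1)) /\
  (forall m n : nat, n <= m -> 6 <= n -> 11 <= m ->
     is_ramsey_number 3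
       (pair_families (berge 3 (complete_graph m)) (berge 3 (cycle_graph n)))
       (m + (n - 1) %/ 2 - 1)).
Proof.
split=> [n m n45 m_ge8 | m n nm n_ge6 m_ge11]; split.
- apply: (@ramsey_property_upper _ m n 2); [lia|lia|lia|] => B hB.
  by apply: short_berge_cycle hB _ _; rewrite ?card_ord; lia.
- move=> M ramM; rewrite leqNgt; apply/negP => ltM.
  apply: (@two_heavy_colouring n m 2 M) ramM; lia.
- have [n6 | n_neq6] := eqVneq n 6.
    apply: (@ramsey_property_upper _ m n 2); [lia|lia|lia|] => B hB.
    by apply: short_berge_cycle hB _ _; rewrite ?card_ord; lia.
  apply: (@ramsey_property_upper _ m n ((n - 1) %/ 2)); [lia|lia|lia|] => B hB.
  by apply: long_berge_cycle nm m_ge11 _ hB; rewrite ?card_ord; lia.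
- move=> M ramM; rewrite leqNgt; apply/negP => ltM.
  apply: (@two_heavy_colouring n m ((n - 1) %/ 2) M) ramM; lia.
Qed.
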